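(* Let $G$ be the complete bipartite graph with vertex classes $V_1$, $|V_1|=m$, and $V_2$, $|V_2|=n$, $1\le m\le n$, let $\mathcal N$ be the set of its perfect matchings (matchings of size $m$), let $U:\mathcal N\to\mathbb R$ be any function, $\beta>0$, and let $\mathcal M$ be the Markov chain on $\mathcal N$ described below. Then for every $\epsilon>0$ the mixing time of $\mathcal M$ satisfies $$\tau_\epsilon\le 32\,m^2n^2\alpha^6\left(c+m\ln n+\ln\epsilon^{-1}\right),$$ where $\alpha=\exp\{\beta(U_{\max}-U_{\min})\}$ and $c=\ln\alpha$.
   Context: The complete bipartite graph has edge set $V_1\times V_2$. A perfect matching is a set $M$ of edges, no two sharing an endpoint, such that every vertex of $V_1$ lies in exactly one edge of $M$. $U_{\max}=\max_{M\in\mathcal N}U(M)$, $U_{\min}=\min_{M\in\mathcal N}U(M)$. Two distinct $M,M'\in\mathcal N$ are adjacent if $M'$ is obtained from $M$ either by replacing an edge $(y,z_1)\in M$ with $(y,z)$ where $z\in V_2$ lies in no edge of $M$, or by replacing two edges $(y,z_1),(y_1,z)\in M$ with $(y,z),(y_1,z_1)$. The chain $\mathcal M$ has $P_{MM'}=\frac{1}{2mn}\min\{1,\exp(\beta(U(M')-U(M)))\}$ for adjacent $M,M'$, $P_{MM'}=0$ for distinct non-adjacent $M,M'$, and $P_{MM}=1-\sum_{M'\ne M}P_{MM'}$. Its stationary distribution is $\pi_M=e^{\beta U(M)}/\sum_{M'\in\mathcal N}e^{\beta U(M')}$. With $P^{(t)}$ the $t$-step transition matrix, $d(t)=\frac12\max_{M'\in\mathcal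 N}\sum_{M\in\mathcal N}|P^{(t)}_{M'M}-\pi_M|$ and $\tau_\epsilon=\min\{t: d(t)\le\epsilon\}$.
   Formalization: The bound is stated only for ε > 0 with c + m ln n + ln ε⁻¹ ≥ 0 (in particular all ε ≤ 1), since for larger ε the right-hand side is negative and the claim is false (e.g. m = n = 1, ε = 2). *)

(* Defs.v *)
From HB Require Import structures.
From mathcomp Require Import all_boot all_order all_algebra.
From mathcomp Require Import all_reals.
From mathcomp Require Import sequences exp.

Set Implicit Arguments.
Unset Strict Implicit.
Unset Printing Implicit Defensive.

Import Order.TTheory GRing.Theory Num.Theory.

Local Open Scope ring_scope.

(* On an empty index type both take the junk value 0; in the theorem every
   index type is nonempty. *)
Definition fmax (R : realType) (T : finType) (f : T -> R) : R :=
  if [pick x : T] is Some x0 then \big[Num.max/f x0]_(x : T) f x else 0.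

Definition fmin (R : realType) (T : finType) (f : T -> R) : R :=
  if [pick x : T] is Some x0 then \big[Num.min/f x0]_(x : T) f x else 0.

Section Matchings.

Variables V1 V2 : finType.

Definition is_matching (M : {set V1 * V2}) : bool :=
  [forall e in M, forall f in M,
     (e != f) ==> (e.1 != f.1) && (e.2 != f.2)].

Definition is_perfect_matching (M : {set V1 * V2}) : bool :=
  is_matching M && [forall y : V1, #|[set e in M | e.1 == y]| == 1%N].

Record pmatching : Type := PMatching {
  edges :> {set V1 * V2};
  edgesP : is_perfect_matching edges
}.

HB.instance Definition _ := [isSub for edges].
HB.instance Definition _ := [Finite of pmatching by <:].

Definition unmatched (M : {set V1 * V2}) (z : V2) : bool :=
  [forall e in M, e.2 != z].

Definition shift_adj (M M' : {set V1 * V2}) : bool :=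
  [exists y : V1, exists z1 : V2, exists z : V2,
     [&& (y, z1) \in M, unmatched M z &
         M' == (y, z) |: (M :\ (y, z1))]].

Definition swap_adj (M M' : {set V1 * V2}) : bool :=
  [exists y : V1, exists z1 : V2, exists y1 : V1, exists z : V2,
     [&& (y, z1) \in M, (y1, z) \in M, (y, z1) != (y1, z) &
         M' == [set (y, z); (y1, z1)] :|: (M :\: [set (y, z1); (y1, z)])]].

Definition adjacent (M M' : pmatching) : bool :=
  (M != M') && (shift_adj M M' || swap_adj M M').

Section Chain.

Variables (R : realType) (U : pmatching -> R) (beta : R).

Definition Umax : R := fmax U.
Definition Umin : R := fmin U.

Definition offdiag (M M' : pmatching) : R :=
  if adjacent M M' then
    (2 * #|V1|%:R * #|V2|%:R)^-1 * Num.min 1 (expR (beta * (U M' - U M)))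
  else 0.

Definition trans (M M' : pmatching) : R :=
  if M == M' then 1 - \sum_(M'' | M'' != M) offdiag M M''
  else offdiag M M'.

Definition trans_mx : 'M[R]_#|{: pmatching}| :=
  \matrix_(i, j) trans (enum_val i) (enum_val j).

Definition trans_step (t : nat) (M M' : pmatching) : R :=
  (trans_mx ^+ t) (enum_rank M) (enum_rank M').

Definition stationary (M : pmatching) : R :=
  expR (beta * U M) / \sum_(M' : pmatching) expR (beta * U M').

Definition tv_dist (t : nat) : R :=
  2^-1 * fmax (fun M' : pmatching =>
                 \sum_(M : pmatching) `|trans_step t M' M - stationary M|).

Definition is_mixing_time (eps : R) (tau : nat) : Prop :=
  tv_dist tau <= eps /\ forall t : nat, tv_dist t <= eps -> (tau <= t)%N.

End Chain.

End Matchings.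

(* Main.v *)
Require Import Defs.
From HB Require Import structures.
From mathcomp Require Import all_boot all_order all_algebra all_fingroup.
From mathcomp Require Import all_reals.
From mathcomp Require Import sequences exp.
From mathcomp Require Import ring lra.

Set Implicit Arguments.
Unset Strict Implicit.
Unset Printing Implicit Defensive.

Import Order.TTheory GRing.Theory Num.Theory.

Local Open Scope ring_scope.

(* The symmetric group of [V2] acts transitively on the perfect matchings, and
   the moves of the chain are exactly the nontrivial actions of transpositions.
   A permutation is a product of transpositions with distinct first entries, and
   each of them permutes the states, so Cauchy-Schwarz bounds
   [\sum_M (f (act u M) - f M) ^+ 2] for every fixed [u] by the sum of the squared
   increments of [f] along all moves; averaging over [u] gives a Poincare
   inequality for the uniform weight.  Comparing [stationary] with the uniform
   weight costs a factor [alpha ^+ 2], so the chain has relaxation constant at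
   most [8 m n^2 alpha^2].  Since every state is held with probability at least
   1/2, each step contracts the variance by this constant, and the densities of
   the [t]-step distributions converge in L2, hence in total variation. *)

(** * The symmetric group of [V2] acting on perfect matchings; moves as transpositions *)

Section PermutationAction.

Variables V1 V2 : finType.
Implicit Types (M N : pmatching V1 V2) (s u : {perm V2}) (y : V1) (z v w : V2).

Lemma edge_exists M y : exists z, (y, z) \in edges M.
Proof.
have /andP[_ /forallP/(_ y)/cards1P[[y' z] eM]] := edgesP M.
have : (y', z) \in [set e in edges M | e.1 == y] by rewrite eM set11.
by rewrite inE /= => /andP[yM /eqP <-]; exists z.
Qed.

(** A perfect matching is handled throughout as an injection from [V1] to [V2]. *)
Definition partner M y : V2 := xchoose (edge_exists M y).

Lemma partner_edge M y : (y, partner M y) \in edges M.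
Proof. exact: (xchooseP (edge_exists M y)). Qed.

Lemma matching_edges M (e f : V1 * V2) : e \in edges M -> f \in edges M ->
  e != f -> (e.1 != f.1) && (e.2 != f.2).
Proof.
move=> eM fM; have /andP[/forallP/(_ e)/implyP/(_ eM)/forallP/(_ f)] := edgesP M.
by move=> /implyP/(_ fM)/implyP.
Qed.

Lemma mem_edges M y z : ((y, z) \in edges M) = (partner M y == z).
Proof.
apply/idP/eqP => [yzM|<-]; last exact: partner_edge.
apply/eqP/negPn/negP => ne.
have := matching_edges yzM (partner_edge M y).
by rewrite xpair_eqE !eqxx /= eq_sym => /(_ ne).
Qed.

Lemma partner_inj M : injective (partner M).
Proof.
move=> y y' eyy'; apply/eqP/negPn/negP => ne.
have := matching_edges (partner_edge M y) (partner_edge M y').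
by rewrite xpair_eqE /= eyy' !eqxx andbT andbF => /(_ ne).
Qed.

Lemma eq_partner M N : partner M =1 partner N -> M = N.
Proof. by move=> e; apply: val_inj; apply/setP => -[y z]; rewrite /= !mem_edges e. Qed.

Lemma graph_perfect (f : V1 -> V2) : injective f ->
  is_perfect_matching [set (y, f y) | y : V1].
Proof.
move=> finj; apply/andP; split.
  apply/forallP => e; apply/implyP => /imsetP[y _ ->].
  apply/forallP => e'; apply/implyP => /imsetP[y' _ ->] /=.
  apply/implyP; rewrite xpair_eqE (inj_eq finj); case: eqP => //= _ _.
apply/forallP => y; apply/cards1P; exists (y, f y); apply/setP => -[y' z].
rewrite !inE /= xpair_eqE; apply/andP/andP => [[/imsetP[x _ [-> ->]] /eqP ->] //|].
by move=> [/eqP -> /eqP ->]; rewrite eqxx; split => //; apply/imsetP; exists y.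
Qed.

Lemma act_subproof s M : injective (s \o partner M).
Proof. exact: inj_comp perm_inj (@partner_inj M). Qed.

Definition act s M : pmatching V1 V2 := PMatching (graph_perfect (@act_subproof s M)).

Lemma partner_act s M y : partner (act s M) y = s (partner M y).
Proof. by apply/eqP; rewrite -mem_edges; apply/imsetP; exists y. Qed.

Lemma act1 M : act 1%g M = M.
Proof. by apply: eq_partner => y; rewrite partner_act perm1. Qed.

(** Products of permutations compose from left to right, so [s] acts first. *)
Lemma actM s u M : act (s * u)%g M = act u (act s M).
Proof. by apply: eq_partner => y; rewrite !partner_act permM. Qed.

Lemma actK s : cancel (act s) (act s^-1%g).
Proof. by move=> M; rewrite -actM mulgV act1. Qed.

Lemma act_inj s : injective (act s).
Proof. exact: can_inj (actK s). Qed.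

Lemma neq_partner M N : M != N -> exists y, partner M y != partner N y.
Proof.
move=> neMN; apply/existsP; apply: contraR neMN; rewrite negb_exists => /forallP e.
by apply/eqP/eq_partner => y; apply/eqP/negPn/e.
Qed.

(* Correcting one partner at a time by a transposition never spoils a vertex on
   which [M] and [N] already agree. *)
Lemma act_transitive M N : exists s, act s M = N.
Proof.
have [k] := ubnP #|[pred y | partner M y != partner N y]|.
elim: k M => // k IHk M; rewrite ltnS => ltk.
have [->|/neq_partner[y ney]] := eqVneq M N; first by exists 1%g; exact: act1.
pose t := tperm (partner M y) (partner N y).
have [|s es] := IHk (act t M); last by exists (t * s)%g; rewrite actM.
apply: leq_trans ltk; apply: proper_card; apply/properP; split.
  apply/subsetP => x; rewrite !inE partner_act; apply: contraNN => /eqP ex.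
  have nexy : x != y by apply: contraNneq ney => <-; rewrite ex.
  rewrite tpermD //; first by rewrite ex.
    by rewrite (inj_eq (@partner_inj M)) eq_sym.
  by rewrite ex (inj_eq (@partner_inj N)) eq_sym.
by exists y; rewrite !inE // partner_act tpermL eqxx.
Qed.

Lemma act_tpermK v w : involutive (act (tperm v w)).
Proof. by move=> M; rewrite -actM tperm2 act1. Qed.

Lemma tperm_neqP v w x : tperm v w x != x ->
  (x = v /\ tperm v w x = w) \/ (x = w /\ tperm v w x = v).
Proof. by case: tpermP => [->|->|]; [left|right|rewrite eqxx]. Qed.

Lemma mem_act_tperm v w M y z :
  ((y, z) \in edges (act (tperm v w) M)) = ((y, tperm v w z) \in edges M).
Proof. by rewrite !mem_edges partner_act (canF_eq (tpermK v w)). Qed.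

Lemma unmatchedP M z : reflect (forall y, partner M y != z) (unmatched M z).
Proof.
apply: (iffP forallP) => [h y|h [y x]].
  by have /implyP/(_ (partner_edge M y)) := h (y, partner M y).
by apply/implyP; rewrite mem_edges => /eqP <-; exact: h.
Qed.

(** No vertex has partner [z] and only [y] has partner [partner M y], so the transposition moves [y]
    alone. *)
Lemma shift_act M y z : unmatched M z ->
  edges (act (tperm (partner M y) z) M) =
    (y, z) |: (edges M :\ (y, partner M y)).
Proof.
move=> /unmatchedP uz; apply/setP => -[x v].
rewrite mem_act_tperm !inE !mem_edges !xpair_eqE.
have [->|nxy] := eqVneq x y => /=.
  case: tpermP => [->|->|/eqP nv /eqP nz].
  - by rewrite eqxx (negbTE (uz y)).
  - by rewrite !eqxx.
  - by rewrite (negbTE nz) eq_sym (negbTE nv).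
case: tpermP => [->|->|_ _] //.
  by rewrite (inj_eq (@partner_inj M)) (negbTE nxy); apply/negbTE/uz.
by rewrite (inj_eq (@partner_inj M)) (negbTE nxy); apply/esym/negbTE/uz.
Qed.

Lemma swap_act M y y1 : y != y1 ->
  edges (act (tperm (partner M y) (partner M y1)) M) =
    [set (y, partner M y1); (y1, partner M y)] :|:
      (edges M :\: [set (y, partner M y); (y1, partner M y1)]).
Proof.
move=> ney; have pe := inj_eq (@partner_inj M); apply/setP => -[x v].
rewrite mem_act_tperm !inE !mem_edges !xpair_eqE.
case: tpermP => [->|->|/eqP nv /eqP nz]; rewrite ?pe ?eqxx ?andbT.
- by rewrite (negbTE ney); case: (x == y); case: (x == y1).
- by rewrite [y1 == y]eq_sym (negbTE ney); case: (x == y); case: (x == y1).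
- by rewrite (negbTE nz) (negbTE nv) !andbF.
Qed.

(** Transposing the partner of [y] with [z] is a shift if [z] is unmatched, and a swap of [y] with
    [y1] if [z] is the partner of [y1]. *)
Lemma adjacent_tpermP M N :
  reflect (M != N /\ exists y z, N = act (tperm (partner M y) z) M)
    (Defs.adjacent M N).
Proof.
apply: (iffP andP) => -[neMN h]; split => //.
  case/orP: h => [/existsP[y /existsP[v /existsP[z /and3P[yv uz /eqP eN]]]]|].
    rewrite mem_edges in yv; move/eqP: yv eN => <- eN.
    by exists y, z; apply: val_inj; exact: etrans eN (esym (shift_act _ uz)).
  move=> /existsP[y /existsP[v /existsP[y1 /existsP[z /and4P[yv yz ne /eqP eN]]]]].
  rewrite !mem_edges in yv yz; move/eqP: yv ne eN => <-; move/eqP: yz => <- ne eN.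
  have ney : y != y1 by apply: contraNneq ne => ->.
  by exists y, (partner M y1); apply: val_inj; exact: etrans eN (esym (swap_act _ ney)).
case: h => y [z eN]; have [uz|] := boolP (unmatched M z).
  apply/orP; left; apply/existsP; exists y; apply/existsP; exists (partner M y).
  by apply/existsP; exists z; rewrite partner_edge uz eN shift_act //= eqxx.
rewrite negb_forall => /existsP[[y1 z1]]; rewrite negb_imply negbK /= mem_edges.
move=> /andP[/eqP ez1 /eqP ez]; rewrite -{}ez -{z1}ez1 {z} in eN.
have ney : y != y1 by apply: contraNneq neMN => e; rewrite eN e tperm1 act1.
apply/orP; right; apply/existsP; exists y; apply/existsP; exists (partner M y).
apply/existsP; exists y1; apply/existsP; exists (partner M y1).
by rewrite !partner_edge xpair_eqE (negbTE ney) eN swap_act //= eqxx.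
Qed.

(** A vertex whose partner changes was matched to [v] or [w], so it can serve as the [y] of
    [adjacent_tpermP]. *)
Lemma adjacent_act_tperm M v w :
  act (tperm v w) M != M -> Defs.adjacent M (act (tperm v w) M).
Proof.
move=> ne; apply/adjacent_tpermP; split; first by rewrite eq_sym.
have [y] := neq_partner ne; rewrite partner_act => /tperm_neqP[[<- _]|[<- _]].
  by exists y, w.
by exists y, v; rewrite tpermC.
Qed.

Lemma adjacent_sym M N : Defs.adjacent M N = Defs.adjacent N M.
Proof.
suff sub : forall A B : pmatching V1 V2, Defs.adjacent A B -> Defs.adjacent B A.
  by apply/idP/idP; exact: sub.
move=> A B /adjacent_tpermP[neAB [y [z eB]]]; set t := tperm _ _ in eB.
have eA : A = act t B by rewrite eB act_tpermK.
by rewrite {1}eA; apply: adjacent_act_tperm; rewrite -eA.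
Qed.

(** A move is determined by a vertex and its new partner. This count is what makes the chain
    lazy. *)
Lemma card_adjacent M : (#|[pred N | Defs.adjacent M N]| <= #|V1| * #|V2|)%N.
Proof.
rewrite -card_prod.
pose F (p : V1 * V2) := act (tperm (partner M p.1) p.2) M.
apply: leq_trans (leq_image_card F predT); apply: subset_leq_card.
apply/subsetP => N; rewrite inE => /adjacent_tpermP[_ [y [z ->]]].
exact: (image_f F (x := (y, z))).
Qed.

(* A vertex whose partner changes determines the transposition up to order. *)
Lemma card_tperm_act M N : M != N ->
  (#|[pred p : V2 * V2 | act (tperm p.1 p.2) M == N]| <= 2)%N.
Proof.
move=> /neq_partner[y ney].
pose a := partner M y; pose b := partner N y.
apply: leq_trans (_ : (#|[set (a, b); (b, a)]| <= 2)%N).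
  apply: subset_leq_card; apply/subsetP => -[v w]; rewrite !inE /= => /eqP eN.
  have eb : b = tperm v w a by rewrite /b -eN partner_act.
  have : tperm v w a != a by rewrite -eb eq_sym.
  by move=> /tperm_neqP[[ea e]|[ea e]]; rewrite eb e ea !xpair_eqE !eqxx ?orbT.
by rewrite cards2; case: (_ != _).
Qed.

Lemma card_pmatching : (#|{: pmatching V1 V2}| <= #|V2| ^ #|V1|)%N.
Proof.
rewrite -card_ffun; apply: (leq_card (fun M => [ffun y => partner M y])).
move=> M N eMN; apply: eq_partner => y.
by have /ffunP/(_ y) := eMN; rewrite !ffunE.
Qed.

End PermutationAction.

(** * Poincare inequality for the uniform weight *)

Section UniformPoincare.

Variables (V1 V2 : finType) (R : realFieldType) (f : pmatching V1 V2 -> R).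
Implicit Types (M N : pmatching V1 V2) (s u : {perm V2}).

(** The squared l2 distance between [f] and its translate by [s]. *)
Definition displacement s : R := \sum_M (f (act s M) - f M) ^+ 2.

(** Unweighted Dirichlet form; every unordered adjacent pair is counted twice. *)
Definition local_energy : R :=
  \sum_M \sum_(N | Defs.adjacent M N) (f N - f M) ^+ 2.

Lemma displacement_ge0 s : 0 <= displacement s.
Proof. by apply: sumr_ge0 => M _; exact: sqr_ge0. Qed.

(** Reindexing by [act s] reduces this to (x + y)^2 <= (1 + 1/c) x^2 + (1 + c) y^2, whose defect is
    the square (x - c y)^2 / c. *)
Lemma displacement_mul s u (c : R) : 0 < c ->
  displacement (s * u)%g <=
    (1 + c^-1) * displacement s + (1 + c) * displacement u.
Proof.
move=> c0; rewrite /displacement [X in _ + _ * X](reindex_inj (act_inj (s := s))).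
rewrite !mulr_sumr -big_split /=; apply: ler_sum => M _; rewrite actM.
set a := f (act u _); set b := f (act s M); set d := f M.
rewrite -subr_ge0.
rewrite (_ : _ - _ = c^-1 * ((b - d) - c * (a - b)) ^+ 2); last by field; lra.
by rewrite mulr_ge0 ?invr_ge0 ?sqr_ge0 // ltW.
Qed.

(* [u] is split as [u' * (v u(v))], where [u'] fixes [v] in addition; the
   weights in [displacement_mul] are chosen so that the constants add up
   linearly in the number of factors. *)
Lemma displacement_perm_on (S : {set V2}) u : perm_on S u ->
  displacement u <=
    #|S|.+1%:R * \sum_(v in S) \sum_w displacement (tperm v w).
Proof.
have [k] := ubnP #|S|; elim: k S u => // k IHk S u; rewrite ltnS => leSk uS.
have disp1 : displacement 1%g = 0.
  by apply: big1 => M _; rewrite act1 subrr expr0n.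
have [S0|[v vS]] := set_0Vmem S.
  suff -> : u = 1%g by rewrite disp1 S0 big_set0 mulr0.
  apply/permP => x; rewrite perm1; apply: (out_perm uS).
  by rewrite S0 inE.
pose t := tperm (u v) v; pose u' := (u * t)%g.
have uvS : u v \in S by rewrite perm_closed.
have u'S : perm_on (S :\ v) u'.
  apply/subsetP => x; rewrite !inE; apply: contraR; rewrite negb_and negbK.
  rewrite permM /t => /orP[/eqP ->|xS]; first by rewrite tpermL.
  rewrite (out_perm uS xS) tpermD //; by apply: contraNneq xS => <-.
have eu : u = (u' * tperm v (u v))%g by rewrite /u' /t tpermC -mulgA tperm2 mulg1.
have eS := cardsD1 v S; rewrite vS in eS.
have leu' := IHk _ _ (leq_trans _ leSk) u'S.
set A := \sum_(w in S :\ v) _ in leu'.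
have {}leu' : displacement u' <= #|S|%:R * A by rewrite eS; apply: leu'; rewrite eS.
have -> : \sum_(w in S) \sum_z displacement (tperm w z) =
    \sum_z displacement (tperm v z) + A.
  by rewrite (big_setD1 v).
have leq_t : displacement (tperm v (u v)) <= \sum_z displacement (tperm v z).
  rewrite (bigD1 (u v)) //= lerDl; apply: sumr_ge0 => z _; exact: displacement_ge0.
set B := \sum_z _ in leq_t *.
have cS : 0 < #|S|%:R :> R by rewrite ltr0n eS.
rewrite [in displacement u]eu; apply: le_trans (displacement_mul _ _ cS) _.
rewrite -natr1 [leRHS]mulrDr addrC; apply: lerD.
  by rewrite [1 + _]addrC ler_wpM2l // addr_ge0 ?ltW.
have -> : (#|S|%:R + 1) * A = (1 + #|S|%:R^-1) * (#|S|%:R * A).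
  by field; rewrite gt_eqF.
by rewrite ler_wpM2l // addr_ge0 ?invr_ge0 ?ltW.
Qed.

(** Each ordered adjacent pair of matchings arises from at most two ordered pairs [(v, w)];
    transpositions fixing the matching contribute zero. *)
Lemma sum_displacement_tperm :
  \sum_v \sum_w displacement (tperm v w) <= 2 * local_energy.
Proof.
rewrite pair_bigA /= exchange_big mulr_sumr /=; apply: ler_sum => M _.
pose F (p : V2 * V2) := act (tperm p.1 p.2) M.
rewrite (partition_big F predT) //= mulr_sumr [leRHS]big_mkcond /=.
apply: ler_sum => N _.
rewrite (eq_bigr (fun=> (f N - f M) ^+ 2)); last by move=> p /eqP <-.
rewrite sumr_const -[_ *+ _]mulr_natl.
have [->|neMN] := eqVneq M N; first by rewrite subrr expr0n /= !mulr0 if_same.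
have [_|nadj] := ifP; first by rewrite ler_wpM2r ?sqr_ge0 // ler_nat card_tperm_act.
rewrite eq_card0 ?mul0r // => p; apply: contraFF nadj => pN.
have eN : F p = N by apply/eqP; exact: pN.
by rewrite -eN adjacent_act_tperm // -/(F p) eN eq_sym.
Qed.

(** By transitivity the sum over the group does not depend on [M]; summing it over all matchings
    evaluates it, since each [s] permutes them. *)
Lemma sum_act (F : pmatching V1 V2 -> R) M :
  #|{: pmatching V1 V2}|%:R * \sum_s F (act s M) =
  #|{: {perm V2}}|%:R * \sum_N F N.
Proof.
have cst N : \sum_s F (act s N) = \sum_s F (act s M).
  have [t <-] := act_transitive M N.
  rewrite [RHS](reindex_inj (mulgI t)); by apply: eq_bigr => s _; rewrite actM.
transitivity (\sum_N \sum_s F (act s N)).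
  by rewrite [RHS](eq_bigr _ (fun N _ => cst N)) sumr_const mulr_natl.
rewrite exchange_big /= mulr_natl -sumr_const; apply: eq_bigr => s _.
by rewrite [RHS](reindex_inj (act_inj (s := s))).
Qed.

Lemma uniform_poincare :
  \sum_M \sum_N (f N - f M) ^+ 2 <=
    #|{: pmatching V1 V2}|%:R * (2 * #|V2|.+1%:R * local_energy).
Proof.
have G0 : 0 < #|{: {perm V2}}|%:R :> R.
  by rewrite ltr0n; apply/card_gt0P; exists 1%g.
rewrite -(ler_pM2l G0) mulr_sumr.
(* The sum over [N] becomes an average over the group, so exchanging sums produces
   [displacement s]. *)
under eq_bigr => M _ do rewrite -(sum_act (fun N => (f N - f M) ^+ 2) M).
rewrite -mulr_sumr exchange_big /= mulrCA ler_wpM2l ?ler0n //.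
set c := 2 * _ * _.
apply: (@le_trans _ _ (\sum_(s : {perm V2}) c)); last by rewrite sumr_const mulr_natl.
apply: ler_sum => s _.
have sT : perm_on setT s by apply/subsetP => x _; rewrite inE.
apply: le_trans (displacement_perm_on sT) _.
rewrite cardsT /c -mulrA mulrCA ler_wpM2l ?ler0n //.
under eq_bigl do rewrite inE.
exact: sum_displacement_tperm.
Qed.

End UniformPoincare.

(** * L2 contraction for a general lazy reversible chain *)

Section LazyReversibleChain.

Variables (R : realFieldType) (T : finType) (P : T -> T -> R) (p : T -> R).
Hypothesis p_gt0 : forall x, 0 < p x.
Hypothesis p_sum : \sum_x p x = 1.
Hypothesis P_ge0 : forall x y, 0 <= P x y.
Hypothesis P_sum : forall x, \sum_y P x y = 1.
Hypothesis P_rev : forall x y, p x * P x y = p y * P y x.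
Hypothesis P_lazy : forall x, 2^-1 <= P x x.
Implicit Types (f g : T -> R).

Definition mean f : R := \sum_x p x * f x.

Definition markov_op f : T -> R := fun x => \sum_y P x y * f y.

Definition variance f : R := mean (fun x => f x ^+ 2) - mean f ^+ 2.

(** The form <f, (1 - P) f> in L2(p). *)
Definition dirichlet f : R :=
  mean (fun x => f x ^+ 2) - mean (fun x => f x * markov_op f x).

(** Reversibility makes [p] stationary. *)
Lemma mean_markov f : mean (markov_op f) = mean f.
Proof.
rewrite /mean /markov_op; under eq_bigr do rewrite mulr_sumr.
rewrite exchange_big /=; apply: eq_bigr => y _.
under eq_bigr do rewrite mulrA P_rev.
by rewrite -mulr_suml -mulr_sumr P_sum mulr1.
Qed.

Lemma variance_pairs f :
  \sum_x \sum_y p x * p y * (f y - f x) ^+ 2 = 2 * variance f.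
Proof.
have inner x : \sum_y p x * p y * (f y - f x) ^+ 2 =
    p x * mean (fun y => f y ^+ 2) - (2 * mean f) * (p x * f x) + p x * f x ^+ 2.
  have -> : p x * f x ^+ 2 = \sum_y p y * (p x * f x ^+ 2).
    by rewrite -mulr_suml p_sum mul1r.
  rewrite /mean !mulr_sumr mulr_suml -sumrB -big_split /=.
  by apply: eq_bigr => y _; ring.
under eq_bigr do rewrite inner.
rewrite big_split sumrB /= -mulr_suml p_sum -mulr_sumr.
by rewrite -/(mean f) -/(mean (fun x => f x ^+ 2)) /variance; ring.
Qed.

Lemma variance_ge0 f : 0 <= variance f.
Proof.
rewrite -(pmulr_rge0 _ (ltr0Sn R 1)) -variance_pairs.
apply: sumr_ge0 => x _; apply: sumr_ge0 => y _.
by apply: mulr_ge0; rewrite ?sqr_ge0 // mulr_ge0 // ltW.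
Qed.

Lemma sum_markov_sqr f x (a : R) : \sum_y P x y * (f y - a) ^+ 2 =
  markov_op (fun y => f y ^+ 2) x - 2 * a * markov_op f x + a ^+ 2.
Proof.
have -> : a ^+ 2 = \sum_y P x y * a ^+ 2 by rewrite -mulr_suml P_sum mul1r.
rewrite /markov_op !mulr_sumr -sumrB -big_split /=.
by apply: eq_bigr => y _; ring.
Qed.

Lemma dirichlet_pairs f :
  \sum_x \sum_y p x * P x y * (f y - f x) ^+ 2 = 2 * dirichlet f.
Proof.
have inner x : \sum_y p x * P x y * (f y - f x) ^+ 2 =
    p x * markov_op (fun y => f y ^+ 2) x
      - 2 * (p x * (f x * markov_op f x)) + p x * f x ^+ 2.
  under eq_bigr do rewrite -mulrA.
  by rewrite -mulr_sumr sum_markov_sqr; ring.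
under eq_bigr do rewrite inner.
rewrite big_split sumrB /= -mulr_sumr -/(mean (markov_op _)) mean_markov.
by rewrite /dirichlet /mean; ring.
Qed.

(* Jensen's inequality for the stochastic matrix [2 P - 1]. *)
Lemma lazy_jensen f x :
  (2 * markov_op f x - f x) ^+ 2 <= 2 * markov_op (fun y => f y ^+ 2) x - f x ^+ 2.
Proof.
set g := 2 * _ - _.
have : 2^-1 * (f x - g) ^+ 2 <= \sum_y P x y * (f y - g) ^+ 2.
  rewrite (bigD1 x) //= -[leLHS]addr0; apply: lerD.
    by rewrite ler_wpM2r ?sqr_ge0.
  by apply: sumr_ge0 => y _; rewrite mulr_ge0 ?sqr_ge0.
rewrite sum_markov_sqr => le_g.
suff : 0 <= 2 * markov_op (fun y => f y ^+ 2) x - f x ^+ 2 - g ^+ 2.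
  by rewrite subr_ge0.
have -> : 2 * markov_op (fun y => f y ^+ 2) x - f x ^+ 2 - g ^+ 2 =
    2 * (markov_op (fun y => f y ^+ 2) x - 2 * g * markov_op f x + g ^+ 2
         - 2^-1 * (f x - g) ^+ 2).
  by rewrite /g; field.
by rewrite mulr_ge0 // subr_ge0.
Qed.

(** With Q = 2P - 1, averaging [lazy_jensen] gives |Qf|^2 <= |f|^2, that is <Pf, Pf> <= <f, Pf>;
    hence the variance loses at least <f, f> - <f, Pf>. *)
Lemma variance_markov f : variance (markov_op f) <= variance f - dirichlet f.
Proof.
rewrite /variance mean_markov /dirichlet.
set A := mean (fun x => f x ^+ 2); set C := mean (fun x => f x * _).
set D := mean (fun x => _ ^+ 2).
suff : D <= C by lra.
have : mean (fun x => (2 * markov_op f x - f x) ^+ 2) <=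
       mean (fun x => 2 * markov_op (fun y => f y ^+ 2) x - f x ^+ 2).
  by apply: ler_sum => x _; rewrite ler_wpM2l ?lazy_jensen // ltW.
have -> : mean (fun x => (2 * markov_op f x - f x) ^+ 2) = 4 * D - 4 * C + A.
  rewrite /D /C /A /mean !mulr_sumr -sumrB -big_split /=.
  by apply: eq_bigr => x _; ring.
have -> : mean (fun x => 2 * markov_op (fun y => f y ^+ 2) x - f x ^+ 2) = 2 * A - A.
  rewrite -{1}[A]mean_markov /A /mean mulr_sumr -sumrB.
  by apply: eq_bigr => x _; ring.
lra.
Qed.

Fixpoint nstep (t : nat) (x y : T) : R :=
  if t is t'.+1 then \sum_z nstep t' x z * P z y else (x == y)%:R.

Lemma nstep_sum t x : \sum_y nstep t x y = 1.
Proof.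
elim: t => [|t IHt] /=.
  by rewrite (bigD1 x) //= eqxx big1 ?addr0 // => y /negbTE; rewrite eq_sym => ->.
rewrite exchange_big /= -[RHS]IHt; apply: eq_bigr => z _.
by rewrite -mulr_sumr P_sum mulr1.
Qed.

Definition density t x : T -> R := fun y => nstep t x y / p y.

(** Reversibility makes P self-adjoint in L2(p), so densities evolve by [markov_op] itself. *)
Lemma densityS t x : density t.+1 x =1 markov_op (density t x).
Proof.
move=> y; rewrite /density /markov_op /= mulr_suml; apply: eq_bigr => z _.
have zn : p z != 0 by rewrite gt_eqF.
have yn : p y != 0 by rewrite gt_eqF.
have -> : P z y = p y * P y z / p z by rewrite -P_rev mulrAC divff // mul1r.
by field; rewrite zn yn.
Qed.

Lemma mean_density t x : mean (density t x) = 1.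
Proof.
rewrite -(nstep_sum t x); apply: eq_bigr => y _.
by rewrite mulrC divfK // gt_eqF.
Qed.

Lemma variance_density0 x : variance (density 0 x) <= (p x)^-1.
Proof.
rewrite /variance mean_density /mean /density /= (bigD1 x) //= big1.
  rewrite eqxx addr0 mul1r expr1n expr2 mulVKf ?gt_eqF //.
  by rewrite gerBl.
by move=> y /negbTE; rewrite eq_sym => ->; rewrite mul0r expr0n /= mulr0.
Qed.

(** Cauchy-Schwarz, in the form that the absolute value of [density t x - 1] has nonnegative
    variance. *)
Lemma sqr_sum_dist_le_variance t x :
  (\sum_y `|nstep t x y - p y|) ^+ 2 <= variance (density t x).
Proof.
pose a y := `|density t x y - 1|.
have -> : \sum_y `|nstep t x y - p y| = mean a.
  apply: eq_bigr => y _; rewrite /a -{2}(gtr0_norm (p_gt0 y)) -normrM.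
  by rewrite mulrBr mulr1 mulrC divfK // gt_eqF.
have : 0 <= variance a by exact: variance_ge0.
rewrite /variance subr_ge0 => /le_trans; apply.
rewrite mean_density expr1n; set D := mean (fun x0 => density _ _ _ ^+ 2).
have -> : mean (fun y => a y ^+ 2) = D - 2 * mean (density t x) + \sum_y p y.
  rewrite /D /mean mulr_sumr -sumrB -big_split /=; apply: eq_bigr => y _.
  by rewrite /a real_normK ?num_real //; ring.
by rewrite mean_density p_sum; lra.
Qed.

Lemma variance_ext f g : f =1 g -> variance f = variance g.
Proof.
by move=> e; congr (_ - _ ^+ 2); apply: eq_bigr => x _; rewrite e.
 Qed.

Lemma lazy_chain_mixing (K : R) : 1 <= K ->
    (forall f, variance f <= K * dirichlet f) ->
  forall t x, (\sum_y `|nstep t x y - p y|) ^+ 2 <= (1 - K^-1) ^+ t / p x.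
Proof.
move=> K1 poincare t x; apply: le_trans (sqr_sum_dist_le_variance t x) _.
have K0 : 0 < K by apply: lt_le_trans K1.
have r0 : 0 <= 1 - K^-1 by rewrite subr_ge0 invf_le1.
elim: t => [|t IHt]; first by rewrite expr0 mul1r variance_density0.
rewrite (variance_ext (densityS t x)) exprS -mulrA.
apply: le_trans (variance_markov _) _; apply: le_trans (ler_wpM2l r0 IHt).
(* By the Poincare hypothesis, one step loses at least [K^-1] times the variance. *)
by rewrite mulrBl mul1r lerD2l lerN2 mulrC ler_pdivrMr // mulrC.
Qed.

End LazyReversibleChain.

(** * Bounds for [fmax] and [fmin] *)

Section FiniteExtrema.

Variables (R : realType) (T : finType) (f : T -> R).

Lemma le_fmax x : f x <= fmax f.
Proof.
rewrite /fmax; case: pickP => [x0 _|/(_ x)//].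
exact: le_bigmax.
Qed.

Lemma fmin_le x : fmin f <= f x.
Proof.
rewrite /fmin; case: pickP => [x0 _|/(_ x)//].
exact: bigmin_le.
Qed.

(** The hypothesis [0 <= b] covers the empty index type, where [fmax] is 0. *)
Lemma fmax_le (b : R) : 0 <= b -> (forall x, f x <= b) -> fmax f <= b.
Proof.
move=> b0 fb; rewrite /fmax; case: pickP => [x0 _|//].
exact: bigmax_le.
Qed.

Lemma fmin_le_fmax : fmin f <= fmax f.
Proof.
have [x _|T0] := pickP (@predT T); first exact: le_trans (fmin_le x) (le_fmax x).
by rewrite /fmin /fmax; case: pickP => // x; have := T0 x.
Qed.

End FiniteExtrema.

(** * The matching chain: stationary weights, Poincare constant, decay of the distance *)

Section MatchingChain.

Variables (R : realType) (V1 V2 : finType) (U : pmatching V1 V2 -> R) (beta : R).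
Hypothesis beta_ge0 : 0 <= beta.
Hypothesis V1_gt0 : (0 < #|V1|)%N.
Hypothesis V2_gt0 : (0 < #|V2|)%N.
Implicit Types M N : pmatching V1 V2.

Let P := trans U beta.
Let p := stationary U beta.
Let m : R := #|V1|%:R.
Let n : R := #|V2|%:R.
Let Z : R := \sum_M expR (beta * U M).
Let alpha : R := expR (beta * (Umax U - Umin U)).
Let pmin : R := expR (beta * Umin U) / Z.

Let m_ge1 : 1 <= m. Proof. by rewrite ler1n. Qed.
Let n_ge1 : 1 <= n. Proof. by rewrite ler1n. Qed.

Let mn_gt0 : 0 < 2 * m * n.
Proof. by rewrite !mulr_gt0 // ltr0n. Qed.

Lemma partition_function_gt0 M : 0 < Z.
Proof.
rewrite /Z (bigD1 M) //= ltr_wpDr ?expR_gt0 //.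
by apply: sumr_ge0 => N _; exact: expR_ge0.
Qed.

Lemma stationary_gt0 M : 0 < p M.
Proof. by rewrite divr_gt0 ?expR_gt0 ?(partition_function_gt0 M). Qed.

Lemma stationary_sum M : \sum_N p N = 1.
Proof. by rewrite -mulr_suml divff // gt_eqF ?(partition_function_gt0 M). Qed.

Lemma pmin_ge0 : 0 <= pmin.
Proof.
by rewrite divr_ge0 ?expR_ge0 //; apply: sumr_ge0 => M _; exact: expR_ge0.
Qed.

Lemma pmin_le M : pmin <= p M.
Proof.
rewrite ler_wpM2r ?invr_ge0 ?(ltW (partition_function_gt0 M)) // ler_expR.
by rewrite ler_wpM2l // fmin_le.
Qed.

Lemma stationary_le M : p M <= alpha * pmin.
Proof.
rewrite /pmin mulrA -expRD -mulrDr subrK.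
rewrite ler_wpM2r ?invr_ge0 ?(ltW (partition_function_gt0 M)) // ler_expR.
by rewrite ler_wpM2l // le_fmax.
Qed.

Lemma card_pmin_le1 : #|{: pmatching V1 V2}|%:R * pmin <= 1.
Proof.
have [->|/card_gt0P[M _]] := posnP #|{: pmatching V1 V2}|; first by rewrite mul0r.
rewrite -[leRHS](stationary_sum M) mulr_natl -sumr_const.
by apply: ler_sum => N _; exact: pmin_le.
Qed.

(** Summing [stationary_le] over at most n^m matchings bounds 1 by a multiple of [pmin]. This
    controls the initial variance. *)
Lemma stationary_inv_le M : (p M)^-1 <= alpha * n ^+ #|V1|.
Proof.
rewrite -[leLHS]mul1r ler_pdivrMr ?stationary_gt0 // -[leLHS](stationary_sum M).
apply: (@le_trans _ _ (\sum_(N : pmatching V1 V2) alpha * pmin)).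
  by apply: ler_sum => N _; exact: stationary_le.
rewrite sumr_const -mulr_natl mulrCA -mulrA ler_wpM2l ?expR_ge0 //.
apply: ler_pM; rewrite ?ler0n ?pmin_ge0 ?pmin_le //.
by rewrite -natrX ler_nat card_pmatching.
Qed.

Lemma alpha_ge1 : 1 <= alpha.
Proof. by rewrite -expR0 ler_expR mulr_ge0 // subr_ge0 fmin_le_fmax. Qed.

(** The Metropolis rule makes the flow symmetric, which gives reversibility, and the minimum is
    bounded below by [pmin]. *)
Lemma stationary_offdiag M N : p M * offdiag U beta M N =
  if Defs.adjacent M N then (2 * m * n)^-1 * Num.min (p M) (p N) else 0.
Proof.
rewrite /offdiag; case: ifP => _; last by rewrite mulr0.
rewrite mulrCA minr_pMr ?(ltW (stationary_gt0 M)) // mulr1; congr (_ * Num.min _ _).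
by rewrite mulrAC -expRD -mulrDr addrC subrK.
Qed.

Lemma offdiag_ge0 M N : 0 <= offdiag U beta M N.
Proof.
rewrite /offdiag; case: ifP => // _.
by rewrite mulr_ge0 ?invr_ge0 ?(ltW mn_gt0) // le_min ler01 expR_ge0.
Qed.

(** There are at most mn neighbours, each entered with probability at most 1/(2mn). *)
Lemma sum_offdiag_le M : \sum_(N | N != M) offdiag U beta M N <= 2^-1.
Proof.
apply: (@le_trans _ _ (\sum_(N | Defs.adjacent M N) (2 * m * n)^-1)).
  rewrite [leLHS]big_mkcond [leRHS]big_mkcond; apply: ler_sum => N _.
  have [adj|nadj] := boolP (Defs.adjacent M N); last first.
    by rewrite /offdiag (negbTE nadj) if_same.
  have i0 : 0 <= (2 * m * n)^-1 by rewrite invr_ge0 ltW.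
  by case: ifP => // _; rewrite /offdiag adj ler_piMr // ge_min lexx.
rewrite sumr_const -[leLHS]mulr_natl ler_pdivrMr //.
rewrite -[2 * m * n]mulrA mulKf ?pnatr_eq0 // -natrM ler_nat.
exact: card_adjacent.
Qed.

Lemma trans_ge_half M : 2^-1 <= P M M.
Proof. by rewrite /P /trans eqxx; have := sum_offdiag_le M; lra. Qed.

Lemma trans_ge0 M N : 0 <= P M N.
Proof.
have [->|ne] := eqVneq M N; first by have := trans_ge_half N; lra.
by rewrite /P /trans (negbTE ne) offdiag_ge0.
Qed.

Lemma trans_sum M : \sum_N P M N = 1.
Proof.
rewrite (bigD1 M) //= {1}/P /trans eqxx.
rewrite [X in _ + X](eq_bigr (offdiag U beta M)) ?subrK //.
by move=> N ne; rewrite /P /trans eq_sym (negbTE ne).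
Qed.

Lemma trans_reversible M N : p M * P M N = p N * P N M.
Proof.
have [->//|ne] := eqVneq M N.
rewrite /P /trans (negbTE ne) eq_sym (negbTE ne) !stationary_offdiag.
by rewrite adjacent_sym minC.
Qed.

(** The product of [4 * n * alpha ^+ 2] from [variance_le_energy] and [2 * m * n] from
    [energy_le_dirichlet]. *)
Let K : R := 8 * m * n ^+ 2 * alpha ^+ 2.

(** Each of the two weights is at most [alpha * pmin]; one factor [pmin] absorbs the number of
    states through [card_pmin_le1]. *)
Lemma variance_le_energy (f : pmatching V1 V2 -> R) M :
  2 * variance p f <= alpha ^+ 2 * pmin * (4 * n * local_energy f).
Proof.
rewrite -(variance_pairs (stationary_sum M)).
have E0 : 0 <= local_energy f.
  by apply: sumr_ge0 => A _; apply: sumr_ge0 => B _; exact: sqr_ge0.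
apply: (@le_trans _ _ ((alpha * pmin) ^+ 2 * \sum_A \sum_B (f B - f A) ^+ 2)).
  rewrite mulr_sumr; apply: ler_sum => A _; rewrite mulr_sumr; apply: ler_sum => B _.
  by rewrite ler_wpM2r ?sqr_ge0 // expr2 ler_pM ?stationary_le ?ltW ?stationary_gt0.
have e0 := expR_ge0 (beta * (Umax U - Umin U)); have q0 := pmin_ge0.
apply: le_trans (ler_wpM2l (sqr_ge0 _) (uniform_poincare f)) _.
set C : R := #|_|%:R; set E := local_energy f in E0 *.
have -> : (alpha * pmin) ^+ 2 * (C * (2 * #|V2|.+1%:R * E)) =
    alpha ^+ 2 * pmin * ((C * pmin) * (2 * #|V2|.+1%:R * E)) by ring.
have a0 : 0 <= alpha ^+ 2 * pmin by rewrite mulr_ge0 ?sqr_ge0.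
rewrite ler_wpM2l //; apply: (@le_trans _ _ (2 * #|V2|.+1%:R * E)).
  by rewrite ler_piMl ?card_pmin_le1 // !mulr_ge0 ?ler0n.
(* 2 (n + 1) <= 4 n because n >= 1. *)
rewrite ler_wpM2r // -natr1 -/n; have := n_ge1; lra.
Qed.

Lemma energy_le_dirichlet (f : pmatching V1 V2 -> R) :
  (2 * m * n)^-1 * pmin * local_energy f <= 2 * dirichlet P p f.
Proof.
rewrite -(dirichlet_pairs trans_sum trans_reversible).
rewrite mulr_sumr; apply: ler_sum => M _.
rewrite mulr_sumr [leLHS]big_mkcond; apply: ler_sum => N _ /=.
case: ifP => adj; last first.
  apply: mulr_ge0; rewrite ?sqr_ge0 // mulr_ge0 ?trans_ge0 //.
  by rewrite ltW // stationary_gt0.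
have ne : M != N by case/andP: adj.
rewrite /P /trans (negbTE ne) stationary_offdiag adj ler_wpM2r ?sqr_ge0 //.
by rewrite ler_wpM2l ?invr_ge0 ?(ltW mn_gt0) // le_min !pmin_le.
Qed.

Lemma matching_poincare (f : pmatching V1 V2 -> R) M :
  variance p f <= K * dirichlet P p f.
Proof.
have K0 : 0 <= K by rewrite /K mulr_ge0 ?sqr_ge0 // mulr_ge0 ?sqr_ge0 // mulr_ge0 ?ler0n.
rewrite -(ler_pM2l (ltr0Sn R 1)); apply: le_trans (variance_le_energy f M) _.
rewrite [leRHS]mulrCA; apply: le_trans (ler_wpM2l K0 (energy_le_dirichlet f)).
have [mn nn] : m != 0 /\ n != 0 by rewrite !pnatr_eq0 -!lt0n V1_gt0 V2_gt0.
rewrite le_eqVlt; apply/orP; left; apply/eqP; rewrite /K; field; by rewrite ?mn ?nn.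
Qed.

Lemma trans_stepE t M N : trans_step U beta t M N = nstep P t M N.
Proof.
elim: t M N => [|t IHt] M N; rewrite /trans_step.
  by rewrite expr0 mxE (inj_eq enum_rank_inj).
rewrite exprSr mxE (reindex enum_rank) /=; last first.
  by exists enum_val => x _; rewrite ?enum_rankK ?enum_valK.
by apply: eq_bigr => A _; rewrite -IHt mxE !enum_rankK.
Qed.

Lemma tv_dist_le (eps : R) t : 0 <= eps ->
    (forall M, \sum_N `|nstep P t M N - p N| <= 2 * eps) ->
  tv_dist U beta t <= eps.
Proof.
move=> eps0 h; rewrite /tv_dist mulrC ler_pdivrMr // mulrC.
apply: fmax_le => [|M]; first by rewrite mulr_ge0.
by under eq_bigr do rewrite trans_stepE.
Qed.

(** Combines (1 - 1/K)^t <= exp(-t/K) with [stationary_inv_le]; [eps] is squared because the L2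
    bound controls the squared distance. *)
Lemma tv_dist_decay (eps : R) t : 0 <= eps ->
    expR (- (t%:R / K)) * (alpha * n ^+ #|V1|) <= eps ^+ 2 ->
  tv_dist U beta t <= eps.
Proof.
move=> eps0 le_eps; apply: tv_dist_le => // M.
(* A factor 2 is given up here to keep the constants simple. *)
apply: (@le_trans _ _ eps); last by lra.
have s0 : 0 <= \sum_N `|nstep P t M N - p N| by exact: sumr_ge0.
rewrite -(ler_pXn2r (n := 2)) ?nnegrE //.
have a1 := alpha_ge1.
have K1 : 1 <= K.
  rewrite /K !mulr_ege1 ?exprn_ege1 //; lra.
apply: le_trans (lazy_chain_mixing stationary_gt0 (stationary_sum M) trans_ge0
  trans_sum trans_reversible trans_ge_half K1 (fun f => matching_poincare f M) t M) _.
apply: le_trans le_eps; apply: ler_pM.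
- by rewrite exprn_ge0 // subr_ge0 invf_le1 // (lt_le_trans ltr01).
- by rewrite invr_ge0 ltW ?stationary_gt0.
- rewrite -mulrN expRM_natl lerXn2r ?nnegrE ?expR_ge0 //.
    by rewrite subr_ge0 invf_le1 // (lt_le_trans ltr01).
  exact: expR_ge1Dx.
- exact: stationary_inv_le.
Qed.

Lemma tv_dist0_le1 : tv_dist U beta 0 <= 1.
Proof.
apply: tv_dist_le => // M.
apply: (@le_trans _ _ (\sum_N (nstep P 0 M N + p N))).
  apply: ler_sum => N _; apply: le_trans (ler_normB _ _) _.
  by rewrite ger0_norm ?ler0n // ger0_norm // ltW ?stationary_gt0.
by rewrite big_split (nstep_sum trans_sum) (stationary_sum M) mulr1.
Qed.

(** A single vertex in [V2] leaves at most one state. *)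
Lemma tv_dist0_trivial : #|V2| = 1%N -> tv_dist U beta 0 <= 0.
Proof.
move=> V21; apply: tv_dist_le => // M.
have /fintype_le1P/(_ M) eqM : (#|{: pmatching V1 V2}| <= 1)%N.
  by apply: leq_trans (card_pmatching _ _) _; rewrite V21 exp1n.
rewrite mulr0 big1 // => N _; rewrite (eqM N) /= eqxx.
have := stationary_sum M; rewrite (bigD1 M) //= big1 ?addr0.
  by move=> ->; rewrite subrr normr0.
by move=> A; rewrite (eqM A) eqxx.
Qed.

End MatchingChain.

(** * The explicit time bound *)

Theorem theorem4 (R : realType) (V1 V2 : finType) (m n : nat)
    (hV1 : #|V1| = m) (hV2 : #|V2| = n) (hm : (1 <= m)%N) (hmn : (m <= n)%N)
    (U : pmatching V1 V2 -> R) (beta : R) (hbeta : 0 < beta)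
    (eps : R) (heps : 0 < eps) :
  let alpha := expR (beta * (Umax U - Umin U)) in
  let c := ln alpha in
  0 <= c + m%:R * ln n%:R + ln eps^-1 ->
  exists tau : nat,
    is_mixing_time U beta eps tau /\
    tau%:R <= 32 * m%:R ^+ 2 * n%:R ^+ 2 * alpha ^+ 6
                * (c + m%:R * ln n%:R + ln eps^-1).
Proof.
move=> alpha c; set L := c + _ + _ => L0; set B := _ * L.
have a1 : 1 <= alpha by apply: alpha_ge1; exact: ltW.
have a0 : 0 < alpha by exact: expR_gt0.
have n_gt0 : (0 < n)%N by exact: leq_trans hm hmn.
have V1_gt0 : (0 < #|V1|)%N by rewrite hV1.
have V2_gt0 : (0 < #|V2|)%N by rewrite hV2.
have B0 : 0 <= B.
  by rewrite mulr_ge0 // mulr_ge0 ?exprn_ge0 ?(ltW a0) // mulr_ge0 ?sqr_ge0 // mulr_ge0 ?sqr_ge0.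
(* Any good time below [B] suffices, since the mixing time is the least one. *)
suff [t0 [t0_eps t0_B]] : exists t0, tv_dist U beta t0 <= eps /\ t0%:R <= B.
  have ex : exists t, tv_dist U beta t <= eps by exists t0.
  case: (ex_minnP ex) => tau tau_eps tau_min; exists tau; split; first by split.
  by apply: le_trans t0_B; rewrite ler_nat; exact: tau_min.
have [eps1|eps_lt1] := leP 1 eps.
  exists 0%N; split => //; apply: le_trans eps1; apply: tv_dist0_le1 => //.
(* For n = 1 the term [ln n] vanishes and [L] may be too small for rounding, but time 0 works. *)
have [n1|n_neq1] := eqVneq n 1%N.
  exists 0%N; split => //; apply: le_trans (ltW heps).
  by apply: tv_dist0_trivial => //; rewrite hV2.
have m1 : 1 <= m%:R :> R by rewrite ler1n.
have n2 : 2 <= n%:R :> R by rewrite ler_nat ltn_neqAle eq_sym n_neq1.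
(* From ln(1/n) <= 1/n - 1 <= -1/2. *)
have ln_n : 2^-1 <= ln n%:R :> R.
  have ni : n%:R^-1 <= 2^-1 :> R by rewrite lef_pV2 ?posrE ?ltr0n.
  have i0 : 0 < n%:R^-1 :> R by rewrite invr_gt0 ltr0n.
  have := @le_ln1Dx R (n%:R^-1 - 1).
  rewrite addrCA subrr addr0 lnV ?posrE ?ltr0n // => /(_ _).
  by move=> h; have := h ltac:(lra); lra.
have c0 : 0 <= c by exact: ln_ge0.
have le0 : 0 <= ln eps^-1 by rewrite ln_ge0 // invf_ge1 // ltW.
have L_half : 2^-1 <= L.
  have : 1 * 2^-1 <= m%:R * ln n%:R :> R by apply: ler_pM => //; rewrite invr_ge0.
  by rewrite /L; lra.
(* [8 * X] is the Poincare constant times [L]. *)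
pose X := m%:R * n%:R ^+ 2 * alpha ^+ 2 * L.
have n4 : 4 <= n%:R ^+ 2 :> R by rewrite expr2; nra.
have X2 : 2 <= X.
  have h1 : 1 * 4 <= m%:R * n%:R ^+ 2 :> R by apply: ler_pM.
  have h2 : 1 * 4 * 1 <= m%:R * n%:R ^+ 2 * alpha ^+ 2.
    by apply: ler_pM; rewrite ?exprn_ege1 ?mulr_ge0.
  have : 1 * 4 * 1 * 2^-1 <= X.
    by apply: ler_pM => //; rewrite ?invr_ge0 ?mulr_ge0.
  by lra.
have XB : 32 * X <= B.
  have -> : B = 32 * X * (m%:R * alpha ^+ 4) by rewrite /B /X; ring.
  by rewrite ler_peMr ?mulr_ege1 ?exprn_ege1 //; lra.
exists (Num.truncn B); split; last by rewrite truncn_le.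
apply: (tv_dist_decay (ltW hbeta)) => //; first exact: ltW.
rewrite hV1 hV2 -/alpha.
set t := Num.truncn B.
(* Rounding [B] down costs less than 1, well within the slack [16 * X]. *)
have tX : 16 * X <= t%:R by have := truncnS_gt B; rewrite -/t -natr1; lra.
have Kt : 2 * L <= t%:R / (8 * m%:R * n%:R ^+ 2 * alpha ^+ 2).
  rewrite ler_pdivlMr; last by rewrite !mulr_gt0 ?exprn_gt0 ?ltr0n.
  apply: le_trans tX; rewrite le_eqVlt; apply/orP; left; apply/eqP.
  by rewrite /X; ring.
have -> : alpha * n%:R ^+ m = expR (c + m%:R * ln n%:R).
  by rewrite expRD expRM_natl !lnK ?posrE ?ltr0n.
have -> : eps ^+ 2 = expR (- (2 * ln eps^-1)).
  by rewrite lnV ?posrE // mulrN opprK expRM_natl lnK ?posrE.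
rewrite -expRD ler_expR.
(* The exponent 2L covers [2 * ln eps^-1] and, as [c] and m ln n are nonnegative, also the initial
   factor exp(c + m ln n). *)
have : 0 <= m%:R * ln n%:R :> R by rewrite mulr_ge0 //; lra.
by move: Kt; rewrite /L; lra.
Qed.
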